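(* Let $G=\langle Q,q_I,\Sigma,\Delta,w,Obs\rangle$ be a weighted game arena with partial observation and let $\epsilon>0$ be rational. If Eve has an observation-based strategy with finite memory that is winning for the objective $\mathsf{MPInf}(\epsilon)$ (or for the objective $\mathsf{MPSup}(\epsilon)$), then there is a window size bound $\mu\in\mathbb{N}_0$ (bounded in terms of the memory used by the strategy) such that the same strategy is winning for Eve for the objective $\mathsf{DirFix}(\mu)$ (with threshold $0$).
   Context: A weighted game arena with partial observation (WGA) is a tuple $G=\langle Q,q_I,\Sigma,\Delta,w,Obs\rangle$ where $Q$ is a finite set of states, $q_I\in Q$ is the initial state, $\Sigma$ is a finite set of actions, $\Delta\subseteq Q\times\Sigma\times Q$ is a total transition relation (for every $(q,\sigma)$ there is $q'$ with $(q,\sigma,q')\in\Delta$), $w:\Delta\to\mathbb{Z}$ is a weight function, and $Obs$ is a partition of $Q$ (the observations) with $\{q_I\}\in Obs$. A concrete path is a sequence $q_0\sigma_0q_1\sigma_1\dots$ with $(q_i,\sigma_i,q_{i+1})\in\Delta$ for all $i$. An abstract path is a sequence $o_0\sigma_0o_1\sigma_1\dots$ with $o_i\in Obs$, $\sigma_i\in\Sigma$, for which some concrete path $q_0\sigma_0q_1\dots$ has $q_i\in o_i$ for all $i$; for an abstract path $\psi$, $\gamma(\psi)$ is the set of concrete paths $q_0\sigma_0q_1\sigma_1\dots$ (with the same actions) with $q_i\in o_i$ for all $i$. For a path $\pi$, $\pi[k..l]$ is its segment from position $k$ to position $l$ and $\pi[..k]=\pi[0..k]$. For a concrete path $\chi=q_0\sigma_0q_1\dots$,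 $w(\chi[k..l])=\sum_{i=k}^{l-1}w(q_i,\sigma_i,q_{i+1})$. A play is an infinite abstract path whose first observation is $\{q_I\}$; $\mathrm{Prefs}(G)$ is the set of finite prefixes of plays ending in an observation. An observation-based strategy for Eve is a map $\lambda:\mathrm{Prefs}(G)\to\Sigma$; a play $o_0\sigma_0o_1\dots$ is consistent with $\lambda$ if $\sigma_i=\lambda(o_0\sigma_0\dots o_i)$ for all $i$. The strategy has finite memory if there are a finite set $M$, $m_0\in M$, and maps $\alpha_u:M\times Obs\to M$, $\alpha_o:M\times Obs\to\Sigma$ with $\lambda(o_0\sigma_0\dots o_n)=\alpha_o(m_n,o_n)$ where $m_{i+1}=\alpha_u(m_i,o_i)$. An objective is a set $V$ of plays; $\lambda$ is winning for $V$ if every play consistent with $\lambda$ lies in $V$. For an infinite concrete path $\pi$, $\underline{\mathsf{MP}}(\pi)=\liminf_{n\to\infty}\frac1n w(\pi[..n])$ and $\overline{\mathsf{MP}}(\pi)=\limsup_{n\to\infty}\frac1n w(\pi[..n])$; $\mathsf{MPInf}(\nu)$ (resp. $\mathsf{MPSup}(\nu)$) is the set of plays $\psi$ such that $\underline{\mathsf{MP}}(\pi)\ge\nu$ (resp. $\overline{\mathsf{MP}}(\pi)\ge\nu$) for all $\pi\in\gamma(\psi)$. Let $\mathbb{N}_0=\{1,2,\dots\}$. For a concrete path $\chi$, $i\ge0$ and $\ell\in\mathbb{N}_0$, $\chi\in\mathsf{GW}(i,\ell)$ iff there is $1\le j\le\ell$ with $w(\chi[i..i+j])\ge0$. $\mathsf{DirFix}(\ell)$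 is the set of plays $\psi$ such that for all $\pi\in\gamma(\psi)$ and all $i\ge0$, $\pi\in\mathsf{GW}(i,\ell)$. *)

(* Defs.v *)
From mathcomp Require Import all_boot all_order all_algebra.
From mathcomp Require Import all_classical all_reals all_analysis.

Set Implicit Arguments.
Unset Strict Implicit.
Unset Printing Implicit Defensive.

Import Order.TTheory GRing.Theory Num.Theory.

Local Open Scope classical_set_scope.
Local Open Scope ring_scope.

(* [weight] is a total function; its values outside [trans] never matter, as
   it is only summed along concrete paths. *)
Record wga := WGA {
  state : finType;
  init : state;
  action : finType;
  trans : {set state * action * state};
  trans_total : forall q a, exists q', (q, a, q') \in trans;
  weight : state * action * state -> int;
  Obs : {set {set state}};
  Obs_partition : finset.partition Obs [set: state]%SET;
  Obs_init : [set init]%SET \in Obs }.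

Definition obs (G : wga) : finType := {o : {set state G} | o \in Obs G}.

(* An infinite alternating sequence v_0 a_0 v_1 a_1 ... *)
Record alt_seq (V A : Type) := AltSeq { vert : nat -> V; act : nat -> A }.

Definition concrete_path (G : wga) : set (alt_seq (state G) (action G)) :=
  [set pi | forall i, (vert pi i, act pi i, vert pi i.+1) \in trans G].

Definition gamma (G : wga) (psi : alt_seq (obs G) (action G)) :
    set (alt_seq (state G) (action G)) :=
  [set pi | [/\ concrete_path pi,
                (forall i, act pi i = act psi i) &
                (forall i, vert pi i \in val (vert psi i))]].

Definition abstract_path (G : wga) : set (alt_seq (obs G) (action G)) :=
  [set psi | exists pi, gamma psi pi].

Record play (G : wga) := Play {
  play_seq :> alt_seq (obs G) (action G);
  play_abstract : abstract_path play_seq;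
  play_init : val (vert play_seq 0%N) = [set init G]%SET }.

(* o_0 a_0 ... a_{n-1} o_n is encoded as ([:: (o_0, a_0); ...], o_n). *)
Definition history (G : wga) : Type := (seq (obs G * action G) * obs G)%type.

Definition prefix_seq (G : wga) (psi : alt_seq (obs G) (action G)) (n : nat) :
    history G :=
  (mkseq (fun i => (vert psi i, act psi i)) n, vert psi n).

Record Prefs (G : wga) := Pref {
  pref_history :> history G;
  prefP : exists (psi : play G) (n : nat), pref_history = prefix_seq psi n }.

Definition play_prefix (G : wga) (psi : play G) (n : nat) : Prefs G :=
  Pref (ex_intro _ psi (ex_intro _ n erefl)).

Definition strategy (G : wga) : Type := Prefs G -> action G.

Definition consistent (G : wga) (lambda : strategy G) (psi : play G) : Prop :=
  forall i, act psi i = lambda (play_prefix psi i).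

Definition winning (G : wga) (lambda : strategy G) (V : set (play G)) : Prop :=
  forall psi : play G, consistent lambda psi -> V psi.

Record memory (G : wga) := Memory {
  mem_state : finType;
  mem_init : mem_state;
  mem_update : mem_state -> obs G -> mem_state;
  mem_out : mem_state -> obs G -> action G }.

(* The memory state used at o_0 a_0 ... o_n has read o_0, ..., o_{n-1}
   but not o_n. *)
Definition implements (G : wga) (M : memory G) (lambda : strategy G) : Prop :=
  forall h : Prefs G,
    lambda h =
    mem_out (foldl (@mem_update G M) (mem_init M) (map fst (pref_history h).1))
            (pref_history h).2.

Definition segment_weight (G : wga) (pi : alt_seq (state G) (action G))
    (k l : nat) : int :=
  \sum_(k <= i < l) weight (vert pi i, act pi i, vert pi i.+1).

(* At n = 0 the quotient is 0 / 0 = 0, which affects neither the limit inferior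
   nor the limit superior. *)
Definition averages (R : realType) (G : wga)
    (pi : alt_seq (state G) (action G)) : nat -> \bar R :=
  fun n => ((segment_weight pi 0 n)%:~R / n%:R)%:E.

Definition MP_inf (R : realType) (G : wga)
    (pi : alt_seq (state G) (action G)) : \bar R := limn_einf (averages R pi).

Definition MP_sup (R : realType) (G : wga)
    (pi : alt_seq (state G) (action G)) : \bar R := limn_esup (averages R pi).

Definition MPInf (R : realType) (G : wga) (nu : rat) : set (play G) :=
  [set psi | forall pi, gamma psi pi -> ((ratr nu)%:E <= MP_inf R pi)%E].

Definition MPSup (R : realType) (G : wga) (nu : rat) : set (play G) :=
  [set psi | forall pi, gamma psi pi -> ((ratr nu)%:E <= MP_sup R pi)%E].

Definition GW (G : wga) (i l : nat) : set (alt_seq (state G) (action G)) :=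
  [set chi | exists j : nat,
     (1 <= j <= l)%N /\ 0 <= segment_weight chi i (i + j)].

Definition DirFix (G : wga) (l : nat) : set (play G) :=
  [set psi | forall pi, gamma psi pi -> forall i, GW i l pi].

(* Main.v *)
(* Fix a play consistent with the strategy and a concretization of it, and look
   at two positions carrying the same state and the same memory value.  Repeating
   the segment between them forever yields another consistent play whose mean
   payoff is the mean weight of that segment, so this mean is at least eps.
   Subtracting eps from every weight thus makes all loops of the (state, memory)
   sequence nonnegative.  A segment splits into at most |Q| * |M| loops and as
   many single transitions, so its weight is at least eps times its length minus
   a constant, which is nonnegative once the segment is long enough. *)

Require Import Defs.
From mathcomp Require Import all_boot all_order all_algebra.
From mathcomp Require Import all_classical all_reals all_analysis.
From mathcomp Require Import zify ring lra.

Set Implicit Arguments.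
Unset Strict Implicit.
Unset Printing Implicit Defensive.

Import Order.TTheory GRing.Theory Num.Theory.

Local Open Scope ring_scope.

Lemma sum_ge_of_cycles_ge0 (F : realDomainType) (T : finType) (s : nat -> T)
    (x : nat -> F) (C : F) :
  (forall i, - C <= x i) ->
  (forall a b, (a < b)%N -> s a = s b -> 0 <= \sum_(a <= i < b) x i) ->
  forall (S : {set T}) a b, (a <= b)%N ->
    (forall i, (a <= i <= b)%N -> s i \in S) -> 0 <= C ->
    - (#|S|%:R * C) <= \sum_(a <= i < b) x i.
Proof.
move=> x_ge cyc S; have [n] := ubnP #|S|.
(* Cut the segment after the last visit to its initial value [s a]: the first
   part is a loop, and the rest avoids [s a]. *)
elim: n S => // n IHn S leSn a b leab sS C_ge0.
have Sa : s a \in S by apply: sS; rewrite leqnn.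
have ex_last : exists c, (a <= c <= b)%N && (s c == s a).
  by exists a; rewrite leqnn leab eqxx.
have last_ub c : (a <= c <= b)%N && (s c == s a) -> (c <= b)%N.
  by case/andP=> /andP[].
case: (ex_maxnP ex_last last_ub) => c /andP[/andP[leac lecb] /eqP sca] max_c.
have ac_ge0 : 0 <= \sum_(a <= i < c) x i.
  have [->|neac] := eqVneq a c; first by rewrite big_geq.
  by apply: cyc; rewrite // ltn_neqAle neac.
rewrite (big_cat_nat leac lecb) /=.
have [<-|necb] := eqVneq c b.
  rewrite [X in _ + X]big_geq // addr0; apply: le_trans ac_ge0.
  by rewrite oppr_le0 mulr_ge0.
have ltcb : (c < b)%N by rewrite ltn_neqAle necb.
(* The transition leaving position [c] costs at most [C], which is paid for by dropping [s a] from
   [S]. *)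
rewrite (big_ltn ltcb).
have cardS := cardsD1 (s a) S; rewrite Sa add1n in cardS.
have: - (#|(S :\ s a)%SET|%:R * C) <= \sum_(c.+1 <= i < b) x i.
  apply: IHn => //; first by move: leSn; rewrite cardS; lia.
  move=> i /andP[ltci leib]; rewrite in_setD1 sS ?andbT; last by lia.
  apply/eqP => sia; have := max_c i; rewrite sia eqxx; lia.
have := x_ge c; rewrite cardS -natr1; lra.
Qed.

(** Since [c] is the mean over one period, the deviation of the partial sums from [n%:R * c] is
    itself periodic from [a] on, hence bounded. *)
Lemma periodic_sum_le (F : realDomainType) (x : nat -> F) (c : F) (a p : nat) :
  (0 < p)%N -> (forall n, (a <= n)%N -> x (n + p)%N = x n) ->
  \sum_(a <= i < a + p) x i = p%:R * c ->
  exists K, forall n, \sum_(0 <= i < n) x i <= K + n%:R * c.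
Proof.
move=> p_gt0 x_per sum_per.
pose f n := \sum_(0 <= i < n) x i - n%:R * c.
have f_per n : (a <= n)%N -> f (n + p)%N = f n.
  move=> /subnKC <-; elim: (n - a)%N => [|k IHk].
    rewrite addn0 /f (@big_cat_nat _ _ _ a 0%N) ?leq_addr //= sum_per natrD.
    ring.
  rewrite addnS addSn /f !big_nat_recr //= x_per ?leq_addr //.
  rewrite -!natr1 !natrD; move: IHk; rewrite /f !natrD; lra.
(* Every value of [f] is already taken below [a + p], so this sum dominates all of them. *)
exists (\sum_(i < a + p) `|f i|) => n; rewrite -lerBlDr -/(f n).
elim/ltn_ind: n => n IHn; have [ltn|len] := ltnP n (a + p).
  rewrite (bigD1 (Ordinal ltn)) //=.
  by rewrite ler_wpDr ?ler_norm ?sumr_ge0.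
have -> : n = (n - p + p)%N by rewrite subnK //; lia.
by rewrite f_per ?IHn //; lia.
Qed.

Lemma limn_esup_le_near (R : realType) (u : nat -> \bar R) (l : \bar R) :
  (\forall n \near \oo%classic, (u n <= l)%E) -> (limn_esup u <= l)%E.
Proof.
move=> u_le; apply: ge_ereal_inf.
exists (ereal_sup (image [set n | (u n <= l)%E]%classic u)).
  by exists [set n | (u n <= l)%E]%classic.
by apply: ge_ereal_sup => _ [n /= un_le <-].
Qed.

Lemma limn_esup_mean_le (R : realType) (u : nat -> R) (K c : R) :
  (forall n, u n <= K + n%:R * c) ->
  (limn_esup (fun n => (u n / n%:R)%:E) <= c%:E)%E.
Proof.
move=> u_le; apply/lee_addgt0Pr => e e_gt0; apply: limn_esup_le_near.
(* From here on [K / n <= e]; the successor keeps [n] away from 0. *)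
exists (Num.bound (K / e)).+1 => // n /= len.
have n_gt0 : 0 < n%:R :> R by rewrite ltr0n; lia.
rewrite -EFinD lee_fin ler_pdivrMr // (le_trans (u_le n)) //.
have : K <= n%:R * e; last by lra.
rewrite -ler_pdivrMr // (le_trans (ltW (unstable.ltr_bound _))) //.
by rewrite ler_nat ltnW.
Qed.

(** Composing a sequence with this index map keeps its first [a] terms and then repeats the [p]
    terms from position [a] forever. *)
Definition lasso (a p n : nat) : nat :=
  if (n < a)%N then n else (a + (n - a) %% p)%N.

Section Lasso.

Variables (a p : nat).
Hypothesis p_gt0 : (0 < p)%N.

Lemma lasso_id n : (n < a + p)%N -> lasso a p n = n.
Proof.
by rewrite /lasso; case: (ltnP n a) => // ? ?; rewrite modn_small; lia.
Qed.

Lemma lassoDp n : (a <= n)%N -> lasso a p (n + p) = lasso a p n.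
Proof.
move=> lean; rewrite /lasso !ltnNge lean (leq_trans lean) ?leq_addr //=.
by rewrite -addnBAC // modnDr.
Qed.

(** The two indices differ only when the loop wraps around, and there they are [a] and [a + p],
    where [s] agrees. *)
Lemma lassoS (T : Type) (s : nat -> T) n :
  s a = s (a + p)%N -> s (lasso a p n.+1) = s (lasso a p n).+1.
Proof.
move=> s_ap; rewrite /lasso; case: (ltnP n a) => [ltna|lean].
  case: ltnP => // lea; suff -> : n.+1 = a by rewrite subnn mod0n addn0.
  lia.
rewrite ltnNge leqW //= subSn // modnS.
case: ifP => [dvd_p|_]; last by rewrite addnS.
rewrite addn0 -addnS s_ap; congr (s (a + _)%N).
apply/eqP; rewrite eqn_leq ltn_pmod // andbT dvdn_leq //.
by rewrite /dvdn -addn1 modnDml addn1.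
Qed.

End Lasso.

Definition reindex (V A : Type) (r : nat -> nat) (psi : alt_seq V A) :=
  AltSeq (vert psi \o r) (act psi \o r).

Lemma obs_inj (G : wga) (o1 o2 : obs G) (q : state G) :
  q \in val o1 -> q \in val o2 -> o1 = o2.
Proof.
move=> q1 q2; apply: val_inj.
have /and3P[_ tI _] := Obs_partition G.
by rewrite -(def_pblock tI (valP o1) q1) (def_pblock tI (valP o2) q2).
Qed.

(** Taken on arbitrary sequences rather than plays, so that it applies directly to a reindexed
    play. *)
Definition mem_at (G : wga) (M : memory G)
    (psi : alt_seq (obs G) (action G)) (n : nat) : mem_state M :=
  foldl (@mem_update G M) (mem_init M) (map fst (prefix_seq psi n).1).

Lemma mem_atS (G : wga) (M : memory G) psi n :
  mem_at M psi n.+1 = mem_update (mem_at M psi n) (vert psi n).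
Proof.
rewrite /mem_at [prefix_seq _ n.+1]/prefix_seq mkseqS.
by rewrite map_rcons foldl_rcons.
Qed.

Section Pumping.

Variables (G : wga) (lambda : strategy G) (M : memory G).
Hypothesis lambda_M : implements M lambda.
Variables (psi : play G) (pi : alt_seq (state G) (action G)).
Hypotheses (psi_cons : consistent lambda psi) (pi_psi : gamma psi pi).
Variables (a p : nat).
Hypotheses (p_gt0 : (0 < p)%N) (vert_loop : vert pi a = vert pi (a + p)%N).
Hypothesis mem_loop : mem_at M psi a = mem_at M psi (a + p)%N.

Local Notation r := (lasso a p).

(** Equal states lie in the same observation, so observation and memory both close up at [a + p]. By
    induction the memory at step [n] of the pumped play is that of [psi] at [r n], and these two
    data determine the action. *)
Lemma lasso_play :
  exists2 psi' : play G,
    consistent lambda psi' & gamma psi' (reindex r pi).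
Proof.
have [pi_path pi_act pi_vert] := pi_psi.
have obs_loop : vert psi a = vert psi (a + p)%N.
  by apply: (obs_inj (pi_vert a)); rewrite vert_loop.
have pi'_psi' : gamma (reindex r psi) (reindex r pi).
  split=> n /=; [|exact: pi_act|exact: pi_vert].
  by rewrite (lassoS p_gt0 _ vert_loop); apply: pi_path.
have psi'_init : val (vert (reindex r psi) 0%N) = [set init G]%SET.
  by rewrite /= lasso_id ?addn_gt0 ?p_gt0 ?orbT // (play_init psi).
exists (Play (ex_intro _ _ pi'_psi') psi'_init) => // n.
have mem_r : mem_at M (reindex r psi) n = mem_at M psi (r n).
  elim: n => [|n IHn]; first by rewrite lasso_id ?addn_gt0 ?p_gt0 ?orbT.
  by rewrite (lassoS p_gt0 _ mem_loop) !mem_atS IHn.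
rewrite lambda_M -/(mem_at M (reindex r psi) n) mem_r /=.
by rewrite psi_cons lambda_M.
Qed.

Lemma loop_weight_ge (R : realType) (eps : rat) :
  winning lambda (@MPInf R G eps) \/ winning lambda (@MPSup R G eps) ->
  p%:R * eps <= (segment_weight pi a (a + p))%:~R.
Proof.
move=> win; have [psi' cons' gamma'] := lasso_play.
(* As the limit inferior is at most the limit superior, both objectives give this bound. *)
have : ((ratr eps)%:E <= MP_sup R (reindex r pi))%E.
  case: win => win; last exact: win gamma'.
  by apply: le_trans (limn_einf_sup _); apply: win gamma'.
set wt := fun i => weight (vert pi i, act pi i, vert pi i.+1).
pose x i : R := (wt (r i))%:~R.
pose c : R := (segment_weight pi a (a + p))%:~R / p%:R.
have p_neq0 : p%:R != 0 :> R by rewrite pnatr_eq0 -lt0n.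
have x_sum : \sum_(a <= i < a + p) x i = p%:R * c.
  rewrite mulrC divfK // rmorph_sum; apply: eq_big_nat => i /andP[_ ltip].
  by rewrite /x lasso_id.
have x_per n : (a <= n)%N -> x (n + p)%N = x n by move=> ?; rewrite /x lassoDp.
have [K x_le] := periodic_sum_le p_gt0 x_per x_sum.
rewrite /MP_sup (_ : averages R _ =
    fun n => ((\sum_(0 <= i < n) x i) / n%:R)%:E); last first.
  apply/funext => n; rewrite /averages rmorph_sum; congr (_ / _)%:E.
  by apply: eq_bigr => i _; rewrite /x /wt /= (lassoS p_gt0 _ vert_loop).
move=> /le_trans/(_ (limn_esup_mean_le x_le)).
rewrite lee_fin ler_pdivlMr ?ltr0n // mulrC.
by rewrite -(ler_rat R) rmorphM /= ratr_nat ratr_int.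
Qed.

End Pumping.

Theorem theorem1 (R : realType) (G : wga) (eps : rat) (eps_gt0 : 0 < eps) :
  exists bound : nat -> nat,
    forall (lambda : strategy G) (M : memory G),
      implements M lambda ->
      winning lambda (@MPInf R G eps) \/ winning lambda (@MPSup R G eps) ->
      exists mu : nat,
        [/\ (1 <= mu)%N,
            (mu <= bound #|mem_state M|)%N &
            winning lambda (@DirFix G mu)].
Proof.
(* The sum dominates each single absolute weight, and [eps] accounts for the shift, so no shifted
   weight is below [- C]. *)
pose C : rat := \sum_(t : state G * action G * state G) `|weight t|%:~R + eps.
have C_ge0 : 0 <= C.
  by rewrite addr_ge0 ?(ltW eps_gt0) // sumr_ge0 // => t _; rewrite ler0z.
(* Chosen so that the gain [mu * eps] exceeds the total loss [#|state G| * k * C]; the successor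
   also ensures [1 <= mu]. *)
pose bound k := (Num.bound ((#|state G| * k)%:R * C / eps)).+1.
exists bound => lambda M lambda_M win; exists (bound #|mem_state M|).
split=> // psi psi_cons pi pi_psi i; set mu := bound _.
(* The full window of length [mu] always has nonnegative weight, so no shorter one is sought. *)
exists mu; split; first by rewrite leqnn.
pose wt j := weight (vert pi j, act pi j, vert pi j.+1).
pose x j : rat := (wt j)%:~R - eps.
pose s j := (vert pi j, mem_at M psi j).
have sum_x k l : (k <= l)%N ->
    \sum_(k <= j < l) x j = (segment_weight pi k l)%:~R - (l - k)%:R * eps.
  by move=> ?; rewrite sumrB rmorph_sum sumr_const_nat mulr_natl.
have x_ge j : - C <= x j.
  rewrite lerBrDr opprD subrK lerNl.
  rewrite (bigD1 (vert pi j, act pi j, vert pi j.+1)) //=.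
  rewrite ler_wpDr ?sumr_ge0 //.
  by rewrite -rmorphN ler_int -normrN ler_norm.
have cyc k l : (k < l)%N -> s k = s l -> 0 <= \sum_(k <= j < l) x j.
  move=> ltkl; rewrite -(subnKC (ltnW ltkl)).
  have: (0 < l - k)%N by rewrite subn_gt0.
  move: (l - k)%N => p p_gt0 [vkl mkl].
  rewrite sum_x ?leq_addr // subr_ge0 addKn.
  exact: (loop_weight_ge lambda_M psi_cons pi_psi p_gt0 vkl mkl win).
have s_in j : (i <= j <= i + mu)%N -> s j \in [set: state G * mem_state M]%SET.
  by rewrite inE.
have := sum_ge_of_cycles_ge0 x_ge cyc (leq_addr _ _) s_in C_ge0.
rewrite sum_x ?leq_addr // addKn cardsT card_prod.
have mu_gt : (#|state G| * #|mem_state M|)%:R * C < mu%:R * eps.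
  rewrite -ltr_pdivrMr // (lt_trans (unstable.ltr_bound _)) // ltr_nat.
  exact: ltnSn.
rewrite -(ler0z rat); lra.
Qed.
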